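(* Let $p=\frac{2\ell}{2\ell-1}$ for some $\ell\in\mathbb{N}$. Then there exists a real number $C_p>1$ such that for every $\varepsilon\in(0,1)$ we have $$N_p^{\overline{\mathrm{disc}}}(\varepsilon,d)\ \ge\ C_p^d\,(1+o(1))\qquad\text{as } d\to\infty,$$ i.e. there is a sequence $(r_d)_{d\ge1}$ (possibly depending on $\varepsilon$) with $r_d\to0$ and $N_p^{\overline{\mathrm{disc}}}(\varepsilon,d)\ge C_p^d(1+r_d)$ for all $d$. In particular, the generalized $L_p$-discrepancy suffers from the curse of dimensionality for all such $p$.
   Context: For points $\mathcal{P}=\{\boldsymbol{x}_1,\dots,\boldsymbol{x}_N\}\subset[0,1)^d$ and real coefficients $\mathcal{A}=\{a_1,\dots,a_N\}$, the generalized discrepancy function is $\overline{\Delta}_{\mathcal{P},\mathcal{A}}(\boldsymbol{t})=\sum_{k=1}^N a_k\mathbf{1}_{[\boldsymbol{0},\boldsymbol{t})}(\boldsymbol{x}_k)-t_1t_2\cdots t_d$ for $\boldsymbol{t}\in[0,1]^d$, where $[\boldsymbol{0},\boldsymbol{t})=[0,t_1)\times\cdots\times[0,t_d)$, and for $p\in[1,\infty)$ the generalized $L_p$-discrepancy is $\overline{L}_{p,N}(\mathcal{P},\mathcal{A})=\left(\int_{[0,1]^d}|\overline{\Delta}_{\mathcal{P},\mathcal{A}}(\boldsymbol{t})|^p\,d\boldsymbol{t}\right)^{1/p}$. Let $\overline{\mathrm{disc}}_p(N,d)=\min_{\mathcal{P},\mathcal{A}}\overline{L}_{p,N}(\mathcal{P},\mathcal{A})$,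 the minimum over all $N$-element point sets in $[0,1)^d$ and all coefficient choices, and $\overline{\mathrm{disc}}_p(0,d)=(p+1)^{-d/p}$ (the $L_p$-norm of $\boldsymbol{t}\mapsto t_1\cdots t_d$). The inverse is $N_p^{\overline{\mathrm{disc}}}(\varepsilon,d)=\min\{N\in\mathbb{N}:\overline{\mathrm{disc}}_p(N,d)\le\varepsilon\,\overline{\mathrm{disc}}_p(0,d)\}$. *)

(* Defs.v *)
From HB Require Import structures.
From mathcomp Require Import all_boot all_order all_algebra.
From mathcomp Require Import all_classical all_reals all_analysis.
Set Implicit Arguments. Unset Strict Implicit. Unset Printing Implicit Defensive.
Import Order.TTheory GRing.Theory Num.Theory.
Import numFieldNormedType.Exports.
Local Open Scope classical_set_scope.
Local Open Scope ring_scope.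

Section GenDisc.
Variable R : realType.

Definition vcons (x : R) (t : nat -> R) : nat -> R :=
  fun i => if i is i'.+1 then t i' else x.

(* Integral over the unit cube [0,1]^d of a function of the first d
   coordinates, as the iterated one-dimensional Lebesgue integral. *)
Fixpoint cube_int (d : nat) (f : (nat -> R) -> R) : R :=
  match d with
  | 0 => f (fun _ => 0)
  | d'.+1 => Rintegral (@lebesgue_measure R) `[0, 1]%classic
               (fun x => cube_int d' (fun t => f (vcons x t)))
  end.

Definition gdisc_fun (d N : nat) (x : 'I_N -> 'I_d -> R) (a : 'I_N -> R)
  (t : nat -> R) : R :=
  \sum_(k < N) a k * (if [forall i : 'I_d, x k i < t i] then 1 else 0)
  - \prod_(i < d) t i.

Definition gLp (p : R) (d N : nat) (x : 'I_N -> 'I_d -> R) (a : 'I_N -> R) : R :=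
  (cube_int d (fun t => `|gdisc_fun x a t| `^ p)) `^ (p^-1).

Definition in_unit_cube (d N : nat) (x : 'I_N -> 'I_d -> R) : Prop :=
  forall k i, 0 <= x k i /\ x k i < 1.

Definition gdisc (p : R) (N d : nat) : R :=
  inf [set v | exists (x : 'I_N -> 'I_d -> R) (a : 'I_N -> R),
                 in_unit_cube x /\ v = gLp p x a].

(* overline{disc}_p(0,d) = (p+1)^(-d/p) *)
Definition gdisc0 (p : R) (d : nat) : R := (p + 1) `^ (- (d%:R) / p).

End GenDisc.

(* Main.v *)
(** Let q = 2l be the conjugate exponent of p, and g(t) = t^(p-1), for which
    Hölder's inequality against t is an equality: the integrals of t g(t) and of
    g^q over [0,1] are both equal to 1/(p+1). Split g = g_0 + g_1 + g_2 so that
    F_c(x) := \int_x^1 g_c vanishes for x >= 1/4 if c = 1 and for x < 1/4 if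
    c = 2, while all the numbers \int t g_c are nonnegative, positive for c = 1, 2,
    and all the mixed moments \int g_(c_1) ... g_(c_q) are nonnegative.

    Expand the d-fold tensor power of g over words in {0,1,2}^d and keep only the
    words w for which, for every node x_k, some factor F_(w_i) vanishes at x_(k,i).
    The resulting function G is orthogonal to the step function of every node, and
    its integral against t_1 ... t_d loses at most N B^d out of (p+1)^(-d), where
    B < 1/(p+1). Since q is even, \int |G|^q is a sum over q-tuples of words of
    products of mixed moments, so dropping words only decreases it and it is at
    most (p+1)^(-d). Young's inequality for Delta and -G then gives
    \int |Delta|^p >= (p+1)^(-d) (1 - p N rho^d) with rho = (p+1) B < 1. *)
Require Import Defs.
From HB Require Import structures.
From mathcomp Require Import all_boot all_order all_algebra.
From mathcomp Require Import all_classical all_reals all_analysis.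
From mathcomp Require Import measurable_realfun ring lra.
Set Implicit Arguments. Unset Strict Implicit. Unset Printing Implicit Defensive.
Import Order.TTheory GRing.Theory Num.Theory.
Import numFieldNormedType.Exports.
Local Open Scope classical_set_scope.
Local Open Scope ring_scope.

(** * Iterated integrals over the unit cube *)

Section CubeIntegral.
Variable R : realType.
Implicit Types (a c s M : R) (f g h H : R -> R) (F G : (nat -> R) -> R).

Local Notation I01 f := (Rintegral (@lebesgue_measure R) `[0, 1]%classic f).

(** Integrability alone is not stable under products, whereas this condition is. The bound is
    confined to [0,1] because [id] and the powers are unbounded on the line. *)
Definition bounded_meas f : Prop :=
  measurable_fun setT f /\ exists M, forall x : R, 0 <= x <= 1 -> `|f x| <= M.

Lemma lebesgue_measure_unit : @lebesgue_measure R `[0, 1]%classic = 1%E.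
Proof. by rewrite lebesgue_measure_itv/= lte_fin ltr01 oppr0 adde0. Qed.

Lemma bounded_meas_integrable f : bounded_meas f ->
  (@lebesgue_measure R).-integrable `[0, 1]%classic (EFin \o f).
Proof.
move=> [mf [M fM]]; apply: measurable_bounded_integrable => //=.
- by rewrite lebesgue_measure_unit ltry.
- exact: measurable_funTS.
- exists M; split; first exact: num_real.
  move=> y My x /=; rewrite in_itv/= => x01.
  by rewrite (le_trans (fM _ x01))// ltW.
Qed.

Lemma bounded_meas_cst c : bounded_meas (fun=> c).
Proof. by split; [exact: measurable_cst|exists `|c|]. Qed.

Lemma bounded_meas_id : bounded_meas id.
Proof.
split; first exact: measurable_id.
by exists 1 => x /andP[x0 x1]; rewrite ger0_norm.
Qed.

Lemma bounded_measD f g : bounded_meas f -> bounded_meas g ->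
  bounded_meas (fun t => f t + g t).
Proof.
move=> [mf [M fM]] [mg [M' gM]]; split; first exact: measurable_funD.
by exists (M + M') => x x01; rewrite (le_trans (ler_normD _ _))// lerD ?fM ?gM.
Qed.

Lemma bounded_measM f g : bounded_meas f -> bounded_meas g ->
  bounded_meas (fun t => f t * g t).
Proof.
move=> [mf [M fM]] [mg [M' gM]]; split; first exact: measurable_funM.
by exists (M * M') => x x01; rewrite normrM ler_pM ?fM ?gM.
Qed.

Lemma bounded_measZ c f : bounded_meas f -> bounded_meas (fun t => c * f t).
Proof. exact/bounded_measM/bounded_meas_cst. Qed.

Lemma bounded_measB f g : bounded_meas f -> bounded_meas g ->
  bounded_meas (fun t => f t - g t).
Proof.
move=> bf /(bounded_measZ (-1)) bg.
rewrite (_ : (fun _ => _) = (fun t => f t + -1 * g t)); first exact: bounded_measD.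
by apply/funext => t; rewrite mulN1r.
Qed.

Lemma bounded_meas_prod (J : finType) (f : J -> R -> R) :
  (forall j, bounded_meas (f j)) -> bounded_meas (fun t => \prod_j f j t).
Proof.
move=> bf; elim: (index_enum J) => [|j s IH].
  under eq_fun do rewrite big_nil; exact: bounded_meas_cst.
under eq_fun do rewrite big_cons; exact: bounded_measM.
Qed.

Lemma bounded_meas_sum (J : finType) (f : J -> R -> R) :
  (forall j, bounded_meas (f j)) -> bounded_meas (fun t => \sum_j f j t).
Proof.
move=> bf; elim: (index_enum J) => [|j s IH].
  under eq_fun do rewrite big_nil; exact: bounded_meas_cst.
under eq_fun do rewrite big_cons; exact: bounded_measD.
Qed.

Lemma bounded_meas_exp n f : bounded_meas f -> bounded_meas (fun t => f t ^+ n).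
Proof.
move=> bf; elim: n => [|n IH].
  under eq_fun do rewrite expr0; exact: bounded_meas_cst.
under eq_fun do rewrite exprS; exact: bounded_measM.
Qed.

Lemma bounded_meas_powR s : 0 <= s -> bounded_meas (fun t => t `^ s).
Proof.
move=> s0; split; first exact: measurable_powR.
exists 1 => x /andP[x0 x1]; rewrite ger0_norm ?powR_ge0//.
have : x `^ s <= 1 `^ s by rewrite ge0_ler_powR// nnegrE.
by rewrite powR1.
Qed.

Lemma bounded_meas_lt a : bounded_meas (fun t => (t < a)%R%:R).
Proof.
split; last by exists 1 => x _; case: (x < a); rewrite ?normr1 ?normr0.
rewrite (_ : (fun _ => _) = (fun t => if t < a then 1 else 0)); last first.
  by apply/funext => t; case: (t < a).
by apply: measurable_fun_ifT => //; apply: measurable_fun_ltr.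
Qed.

Lemma bounded_meas_gt a : bounded_meas (fun t => (a < t)%R%:R).
Proof.
split; last by exists 1 => x _; case: (a < x); rewrite ?normr1 ?normr0.
rewrite (_ : (fun _ => _) = (fun t => if a < t then 1 else 0)); last first.
  by apply/funext => t; case: (a < t).
by apply: measurable_fun_ifT => //; apply: measurable_fun_ltr.
Qed.

(** * Integration over the unit interval: linearity and comparison *)

Lemma I01D f g : bounded_meas f -> bounded_meas g ->
  I01 (fun t => f t + g t) = I01 f + I01 g.
Proof. by move=> bf bg; rewrite RintegralD//; exact: bounded_meas_integrable. Qed.

Lemma I01B f g : bounded_meas f -> bounded_meas g ->
  I01 (fun t => f t - g t) = I01 f - I01 g.
Proof. by move=> bf bg; rewrite RintegralB//; exact: bounded_meas_integrable. Qed.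

Lemma I01Z c f : bounded_meas f -> I01 (fun t => c * f t) = c * I01 f.
Proof. by move=> bf; rewrite RintegralZl//; exact: bounded_meas_integrable. Qed.

Lemma I01_cst c : I01 (fun=> c) = c.
Proof.
rewrite Rintegral_cst//; have /= -> := lebesgue_measure_unit.
by rewrite mulr1.
Qed.

Lemma I01_sum (J : finType) (f : J -> R -> R) :
  (forall j, bounded_meas (f j)) ->
  I01 (fun t => \sum_j f j t) = \sum_j I01 (f j).
Proof.
move=> bf.
suff [] : bounded_meas (fun t => \sum_j f j t) /\
    I01 (fun t => \sum_j f j t) = \sum_j I01 (f j) by [].
elim: (index_enum J) => [|j s [bs IH]].
  under eq_fun do rewrite big_nil; rewrite big_nil I01_cst.
  by split => //; exact: bounded_meas_cst.
under eq_fun do rewrite big_cons; rewrite big_cons I01D// IH.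
by split => //; exact: bounded_measD.
Qed.

Lemma le_I01 f g : bounded_meas f -> bounded_meas g ->
  (forall t : R, 0 <= t <= 1 -> f t <= g t) -> I01 f <= I01 g.
Proof.
move=> bf bg fg; apply: le_Rintegral => //;
exact: bounded_meas_integrable.
Qed.

Lemma I01_ge0 f : (forall t : R, 0 <= t <= 1 -> 0 <= f t) -> 0 <= I01 f.
Proof. by move=> f0; apply: Rintegral_ge0 => t /=; rewrite in_itv/=; exact: f0. Qed.

Lemma I01_lt a : 0 <= a <= 1 -> I01 (fun t => (t < a)%R%:R) = a.
Proof.
move=> /andP[a0 a1].
have -> : I01 (fun t => (t < a)%R%:R) = I01 (\1_(`[0, a[%classic : set R)).
  apply: eq_Rintegral => t; rewrite inE/= in_itv/= => /andP[t0 t1].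
  change ((t < a)%R%:R = (t \in (`[0, a[%classic : set R))%:R :> R); congr (_%:R).
  case: (ltP t a) => ta; first by rewrite mem_set//= in_itv/= t0 ta.
  by rewrite memNset//= in_itv/= t0/=; apply/negP; rewrite -leNgt.
rewrite /Rintegral integral_indic//.
have -> : `[0, a[%classic `&` `[0, 1]%classic = `[0, a[%classic :> set R.
  apply/seteqP; split => t /=; first by case.
  rewrite !in_itv/= => /andP[t0 ta]; split; first by rewrite t0.
  by rewrite t0/= (le_trans (ltW ta)).
suff /= -> : @lebesgue_measure R `[0, a[%classic = a%:E by [].
rewrite lebesgue_measure_itv/= lte_fin.
by case: ltgtP a0 => //= [a0 _|<- //]; rewrite oppr0 adde0.
Qed.

(* No measurability of the dominating functions is needed: the integral of a
   nonnegative function is a supremum over the simple functions below it. *)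
Lemma ge0_le_integral_nonmeas (D : set R) (f g : R -> \bar R) :
  (forall x, D x -> 0 <= f x)%E -> (forall x, D x -> f x <= g x)%E ->
  (\int[@lebesgue_measure R]_(x in D) f x <=
   \int[@lebesgue_measure R]_(x in D) g x)%E.
Proof.
move=> f0 fg; rewrite integral_mkcond [leRHS]integral_mkcond.
have fg' x : ((f \_ D) x <= (g \_ D) x)%E by apply: lee_restrict.
have f0' x : (0 <= (f \_ D) x)%E by apply: erestrict_ge0.
rewrite !ge0_integralTE//; last by move=> x; exact: le_trans (fg' x).
by apply: le_ereal_sup => _ /= [h hf <-]; exists h => // x; exact: le_trans (fg' x).
Qed.

(** Here [H] stands for a partial integral of |Delta|^p, known only through pointwise bounds. The
    bound by [M] is returned as well, so that the comparison can be iterated over the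
    coordinates. *)
Lemma le_I01_nonmeas h H M : bounded_meas h ->
  (forall t : R, 0 <= t <= 1 -> h t <= H t) ->
  (forall t : R, 0 <= t <= 1 -> 0 <= H t <= M) ->
  I01 h <= I01 H /\ 0 <= I01 H <= M.
Proof.
move=> bh hH HM.
have H0 t : `[0, 1]%classic t -> 0 <= H t.
  by rewrite /= in_itv/= => /HM /andP[].
have upper : (\int[@lebesgue_measure R]_(x in `[0%R, 1%R]%classic) (H x)%:E <= M%:E)%E.
  apply: (@le_trans _ _ (\int[@lebesgue_measure R]_(x in `[0%R, 1%R]%classic) M%:E)%E).
    apply: ge0_le_integral_nonmeas => x x01; rewrite lee_fin; first exact: H0.
    by move: x01; rewrite /= in_itv/= => /HM /andP[].
  rewrite integral_cst//; have /= -> := lebesgue_measure_unit.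
  by rewrite mule1.
(* [fine] would send an infinite integral to 0, so finiteness has to be secured first. *)
have fin : (\int[@lebesgue_measure R]_(x in `[0%R, 1%R]%classic) (H x)%:E)%E \is a fin_num.
  rewrite ge0_fin_numE ?(le_lt_trans upper) ?ltry//.
  by apply: integral_ge0 => x x01; rewrite lee_fin H0.
split; last first.
  apply/andP; split; first exact: Rintegral_ge0.
  by rewrite /Rintegral -lee_fin fineK.
have bm : bounded_meas (fun t => `|h t|).
  case: bh => mh [K hK]; split; first exact: measurableT_comp.
  by exists K => x /hK; rewrite normr_id.
(* This is the positive part of [h]: it dominates [h], and it lies below [H] because [H] is
   nonnegative. *)
have bp : bounded_meas (fun t => 2^-1 * (h t + `|h t|)).
  exact/bounded_measZ/bounded_measD.
apply: (@le_trans _ _ (I01 (fun t => 2^-1 * (h t + `|h t|)))).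
  by apply: le_I01 => // t _; have := ler_norm (h t); lra.
rewrite /Rintegral; apply: fine_le => //.
  exact/integrable_fin_num/bounded_meas_integrable.
apply: ge0_le_integral_nonmeas => x; rewrite /= in_itv/= => x01; rewrite lee_fin.
  by have := ler_norm (- h x); rewrite normrN; lra.
have := hH _ x01; have /andP[Hx0 _] := HM _ x01.
by case: (ger0P (h x)) => h0; lra.
Qed.

(* [Rintegral] is total and additive only on integrable functions, so [cube_int]
   is not additive in general; this predicate certifies the integrability at every
   stage of the iteration. *)
Fixpoint cube_integral (d : nat) F (v : R) : Prop :=
  match d with
  | 0 => F (fun=> 0) = v
  | d'.+1 => exists2 h, bounded_meas h &
      (forall x : R, 0 <= x <= 1 -> cube_integral d' (fun t => F (vcons x t)) (h x))
      /\ I01 h = v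
  end.

Lemma cube_integral_eq d F v : cube_integral d F v -> cube_int d F = v.
Proof.
elim: d F v => //= d IH F v [h bh [Fh <-]].
apply: eq_Rintegral => x; rewrite inE/= in_itv/= => x01.
exact/IH/Fh.
Qed.

Lemma cube_integralD d F G u v : cube_integral d F u -> cube_integral d G v ->
  cube_integral d (fun t => F t + G t) (u + v).
Proof.
elim: d F G u v => [|d IH] F G u v /=; first by move=> -> ->.
move=> [h bh [Fh <-]] [k bk [Gk <-]].
exists (fun x => h x + k x); first exact: bounded_measD.
by split; [move=> x x01; apply: IH; [exact: Fh|exact: Gk]|rewrite I01D].
Qed.

Lemma cube_integralZ d c F v : cube_integral d F v ->
  cube_integral d (fun t => c * F t) (c * v).
Proof.
elim: d F v => [|d IH] F v /=; first by move=> ->.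
move=> [h bh [Fh <-]]; exists (fun x => c * h x); first exact: bounded_measZ.
by split; [move=> x x01; apply: IH; exact: Fh|rewrite I01Z].
Qed.

Lemma cube_integral0 d : cube_integral d (fun=> 0) 0.
Proof.
elim: d => //= d IH; exists (fun=> 0); first exact: bounded_meas_cst.
by split => //; rewrite I01_cst.
Qed.

Lemma cube_integral_sum (J : Type) (r : seq J) (P : pred J) d
    (F : J -> (nat -> R) -> R) (v : J -> R) :
  (forall j, P j -> cube_integral d (F j) (v j)) ->
  cube_integral d (fun t => \sum_(j <- r | P j) F j t) (\sum_(j <- r | P j) v j).
Proof.
move=> FP; elim: r => [|j r IH].
  rewrite big_nil; under eq_fun do rewrite big_nil; exact: cube_integral0.
rewrite big_cons; under eq_fun do rewrite big_cons.
by case: ifPn => // Pj; apply: cube_integralD => //; exact: FP.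
Qed.

Lemma cube_integral_sum0 (J : Type) (r : seq J) (P : pred J) d
    (F : J -> (nat -> R) -> R) :
  (forall j, P j -> cube_integral d (F j) 0) ->
  cube_integral d (fun t => \sum_(j <- r | P j) F j t) 0.
Proof. by move/(cube_integral_sum (v := fun=> 0) r); rewrite big1. Qed.

Lemma cube_integral_prod d (f : 'I_d -> R -> R) :
  (forall i, bounded_meas (f i)) ->
  cube_integral d (fun t => \prod_(i < d) f i (t i)) (\prod_(i < d) I01 (f i)).
Proof.
elim: d f => [|d IH] f bf /=; first by rewrite !big_ord0.
pose v := \prod_(i < d) I01 (f (lift ord0 i)).
exists (fun x => v * f ord0 x); first exact: bounded_measZ.
split; last by rewrite I01Z// big_ord_recl mulrC.
move=> x x01; rewrite mulrC.
under eq_fun do rewrite big_ord_recl/=.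
by apply: cube_integralZ; apply: (IH (fun i => f (lift ord0 i))).
Qed.

Lemma le_cube_int d F v (H : (nat -> R) -> R) M : cube_integral d F v ->
  (forall t, (forall i, 0 <= t i <= 1) -> F t <= H t) ->
  (forall t, (forall i, 0 <= t i <= 1) -> 0 <= H t <= M) ->
  v <= cube_int d H /\ 0 <= cube_int d H <= M.
Proof.
elim: d F v H => [|d IH] F v H /=.
  by move=> <- FH HM; split; [apply: FH|apply: HM] => _; rewrite lexx ler01.
move=> [h bh [Fh <-]] FH HM.
have step x : 0 <= x <= 1 ->
    h x <= cube_int d (fun t => H (vcons x t)) /\
    0 <= cube_int d (fun t => H (vcons x t)) <= M.
  move=> x01; apply: (IH _ _ _ (Fh x x01)) => t t01;
    [apply: FH|apply: HM]; by case.
by apply: le_I01_nonmeas => // x /step[].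
Qed.

End CubeIntegral.

(** * The fooling function *)

(** Young's inequality for |y| and |z|, multiplied by p, with p/q = p - 1. Evenness of q turns |z|^q
    into z^q, so the bound is linear in y and polynomial in z and can be integrated exactly. *)
Lemma young_lower_bound (R : realType) (p : R) (q : nat) (y z : R) :
  0 < p -> (0 < q)%N -> ~~ odd q -> p^-1 + (q%:R)^-1 = 1 ->
  - (p * (y * z)) - (p - 1) * z ^+ q <= `|y| `^ p.
Proof.
move=> p0 q0 evq pq.
have q0' : 0 < q%:R :> R by rewrite ltr0n.
have := conjugate_powR (normr_ge0 y) (normr_ge0 z) p0 q0' pq.
rewrite powR_mulrn// -normrM -normrX.
rewrite (ger0_norm (exprn_even_ge0 _ evq)) => Y.
have pqE : p * (q%:R)^-1 = p - 1.
  have : p * (p^-1 + (q%:R)^-1) = p by rewrite pq mulr1.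
  by rewrite mulrDr mulfV ?gt_eqF//; lra.
have := ler_wpM2l (ltW p0) Y.
rewrite mulrDr (mulrCA p (z ^+ q)) pqE (mulrCA p (_ `^ _)) mulfV ?gt_eqF// mulr1.
rewrite [z ^+ q * _]mulrC.
have : - (p * (y * z)) <= p * `|y * z|.
  by rewrite -mulrN ler_wpM2l ?(ltW p0)// -normrN ler_norm.
lra.
Qed.

(** Writing the box indicator as a product lets its integrals against word functions factor over
    coordinates. *)
Lemma gdisc_fun_indic (R : realType) (d N : nat) (x : 'I_N -> 'I_d -> R)
    (a : 'I_N -> R) (t : nat -> R) :
  gdisc_fun x a t =
  \sum_(k < N) a k * \prod_(i < d) (x k i < t i)%R%:R - \prod_(i < d) t i.
Proof.
congr (_ - _); apply: eq_bigr => k _; congr (_ * _).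
case: ifPn => [/forallP xt|].
  by rewrite big1// => i _; rewrite xt.
rewrite negb_forall => /existsP[i /negbTE xi].
by rewrite (bigD1 i)//= xi mul0r.
Qed.

Lemma gdisc_fun_bounded (R : realType) (d N : nat) (x : 'I_N -> 'I_d -> R)
    (a : 'I_N -> R) (t : nat -> R) : (forall i, 0 <= t i <= 1) ->
  `|gdisc_fun x a t| <= \sum_k `|a k| + 1.
Proof.
move=> t01; rewrite (le_trans (ler_normB _ _))// lerD//.
  rewrite (le_trans (ler_norm_sum _ _ _))// ler_sum// => k _.
  by case: ifP; rewrite ?mulr1 ?mulr0 ?normr0.
rewrite normr_prod prodr_ile1// => i _.
by have /andP[ti0 ti1] := t01 i; rewrite normr_ge0 ger0_norm.
Qed.

Section FoolingFunction.
(** [T] indexes the pieces of g. When [compat c x] fails, the piece c is orthogonal to the step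
    function at x. [A] is the full first moment of g, and [B] bounds what the pieces compatible with
    a given x contribute to it. *)
Variables (R : realType) (T : finType) (gam : T -> R -> R) (compat : T -> R -> bool).
Variables (p : R) (q : nat) (A B : R).

Local Notation I01 f := (Rintegral (@lebesgue_measure R) `[0, 1]%classic f).
Local Notation alpha c := (I01 (fun t => t * gam c t)).

Hypothesis p0 : 0 < p.
Hypothesis q0 : (0 < q)%N.
Hypothesis evq : ~~ odd q.
Hypothesis pq : p^-1 + (q%:R)^-1 = 1.
Hypothesis p1 : 0 <= p - 1.
Hypothesis bgam : forall c, bounded_meas (gam c).
Hypothesis gam_vanish : forall c (x : R), ~~ compat c x ->
  I01 (fun t => (x < t)%R%:R * gam c t) = 0.
Hypothesis alpha_ge0 : forall c, 0 <= alpha c.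
Hypothesis alpha_compat : forall x, \sum_(c | compat c x) alpha c <= B.
Hypothesis gam_pos : forall F : {ffun 'I_q -> T},
  0 <= I01 (fun t => \prod_j gam (F j) t).
Hypothesis IA : I01 (fun t => t * \sum_c gam c t) = A.
Hypothesis IAq : I01 (fun t => (\sum_c gam c t) ^+ q) = A.

(** * Sums over words in the tensor power *)

Section Words.
Variable d : nat.
Local Notation word := {ffun 'I_d -> T}.

Definition word_fun (w : word) (t : nat -> R) : R := \prod_(i < d) gam (w i) (t i).

Definition words_fun (W : pred word) (t : nat -> R) : R :=
  \sum_(w | W w) word_fun w t.

Definition words_moment (W : pred word) : R :=
  \sum_(F : {ffun 'I_q -> word} | F \in ffun_on W)
    \prod_(i < d) I01 (fun t => \prod_j gam (F j i) t).

Lemma words_fun_exp W t : words_fun W t ^+ q =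
  \sum_(F : {ffun 'I_q -> word} | F \in ffun_on W)
    \prod_(i < d) \prod_j gam (F j i) (t i).
Proof.
rewrite -[in LHS](card_ord q) -prodr_const bigA_distr_big.
by apply: eq_bigr => F _; rewrite exchange_big.
Qed.

Lemma cube_integral_words_exp W :
  cube_integral d (fun t => words_fun W t ^+ q) (words_moment W).
Proof.
under eq_fun do rewrite words_fun_exp.
apply: cube_integral_sum => F _.
apply: (@cube_integral_prod _ d (fun i s => \prod_j gam (F j i) s)) => i.
exact: bounded_meas_prod.
Qed.

(** Enlarging W to all words adds only nonnegative terms, by [gam_pos]; for all words the sum is the
    tensor power of g, whose q-th moment is a product of d factors A. *)
Lemma words_moment_le W : words_moment W <= A ^+ d.
Proof.
have -> : A ^+ d = words_moment predT.
  rewrite -(cube_integral_eq (cube_integral_words_exp predT)).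
  have -> : A ^+ d = \prod_(i < d) I01 (fun t => (\sum_c gam c t) ^+ q).
    by rewrite prodr_const card_ord IAq.
  apply/esym/cube_integral_eq.
  rewrite (_ : (fun _ => _) =
      (fun t : nat -> R => \prod_(i < d) (\sum_c gam c (t i)) ^+ q)); last first.
    by apply/funext => t; rewrite prodrXl bigA_distr_bigA.
  apply: (@cube_integral_prod _ d (fun i s => (\sum_c gam c s) ^+ q)) => i.
  exact/bounded_meas_exp/bounded_meas_sum.
rewrite /words_moment [leRHS](bigID (mem (ffun_on W)))/=.
rewrite [X in _ <= X + _](eq_bigl (mem (ffun_on W))); last first.
  by move=> F /=; rewrite andb_idl// => _; apply/ffun_onP.
rewrite lerDl sumr_ge0// => F _; rewrite prodr_ge0// => i _.
rewrite (_ : (fun t => _) = (fun t => \prod_j gam ([ffun j => F j i] j) t)).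
  exact: gam_pos.
by apply/funext => t; apply: eq_bigr => j _; rewrite ffunE.
Qed.

Variables (N : nat) (x : 'I_N -> 'I_d -> R) (a : 'I_N -> R).

Definition fits (w : word) k := [forall i, compat (w i) (x k i)].

(** The words kept in G: for each node some coordinate is incompatible, so by [gam_vanish] the word
    function is orthogonal to that node's step function. *)
Definition alive : pred word := [pred w | [forall k, ~~ fits w k]].

(** A union bound: each dropped word fits some node, and the words fitting one node form a product
    set, whose total weight factors into d sums, each at most B. *)
Lemma sum_alive_ge :
  A ^+ d - N%:R * B ^+ d <= \sum_(w | alive w) \prod_(i < d) alpha (w i).
Proof.
have pos (w : word) : 0 <= \prod_(i < d) alpha (w i) by exact: prodr_ge0.
have -> : A ^+ d = \sum_(w : word) \prod_(i < d) alpha (w i).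
  rewrite -(bigA_distr_bigA (fun (i : 'I_d) c => alpha c)) prodr_const card_ord.
  congr (_ ^+ d); rewrite -IA -I01_sum; last first.
    by move=> c; exact: bounded_measM (@bounded_meas_id R) _.
  by congr Rintegral; apply/funext => t; rewrite mulr_sumr.
rewrite (bigID alive)/= lerBlDr lerD2l.
apply: (@le_trans _ _ (\sum_(k < N) \sum_(w | fits w k) \prod_(i < d) alpha (w i))).
  rewrite (exchange_big_dep predT)//= big_mkcond/=.
  apply: ler_sum => w _; case: ifPn => [|_]; last by apply: sumr_ge0.
  rewrite negb_forall => /existsP[k /negPn kw].
  by rewrite (bigD1 k)//= lerDl sumr_ge0.
rewrite mulr_natl -[in leRHS](card_ord N) -sumr_const; apply: ler_sum => k _.
rewrite (eq_bigl (mem (family (fun i : 'I_d => [pred c | compat c (x k i)])))); last first.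
  by move=> w; apply/forallP/familyP => h i; have := h i; rewrite inE.
rewrite -(bigA_distr_big_dep _ (fun (i : 'I_d) c => alpha c)).
rewrite -[in leRHS](card_ord d) -prodr_const; apply: ler_prod => i _.
by rewrite sumr_ge0//= alpha_compat.
Qed.

(** Each node term integrates to 0 against an alive word, so only the product of the coordinates
    contributes. *)
Lemma cube_integral_gdisc_fun_words :
  cube_integral d (fun t => gdisc_fun x a t * words_fun alive t)
    (- \sum_(w | alive w) \prod_(i < d) alpha (w i)).
Proof.
rewrite -[X in cube_integral d _ X]mulN1r -[X in cube_integral d _ X]add0r.
rewrite [X in cube_integral d X _](_ : _ = (fun t : nat -> R =>
    \sum_(w | alive w)
      \sum_(k < N) a k * \prod_(i < d) ((x k i < t i)%R%:R * gam (w i) (t i)) +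
    -1 * \sum_(w | alive w) \prod_(i < d) (t i * gam (w i) (t i)))); last first.
  apply/funext => t; rewrite gdisc_fun_indic mulrBl mulN1r; congr (_ - _).
    rewrite mulr_sumr; apply: eq_bigr => w _; rewrite mulr_suml.
    by apply: eq_bigr => k _; rewrite -mulrA big_split.
  by rewrite mulr_sumr; apply: eq_bigr => w _; rewrite big_split.
apply: cube_integralD.
  apply: cube_integral_sum0 => w /forallP wx.
  apply: cube_integral_sum0 => k _; rewrite -[X in cube_integral d _ X](mulr0 (a k)).
  apply: cube_integralZ.
  have := @cube_integral_prod _ d (fun i t => (x k i < t)%R%:R * gam (w i) t)
    (fun i => bounded_measM (bounded_meas_gt _) (bgam _)).
  have := wx k; rewrite negb_forall => /existsP[i wi].
  by rewrite (bigD1 i)//= gam_vanish// mul0r.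
apply: cube_integralZ; apply: cube_integral_sum => w _.
apply: (@cube_integral_prod _ d (fun i t => t * gam (w i) t)) => j.
exact: bounded_measM (@bounded_meas_id R) _.
Qed.

(** Integrating Young's inequality with z = G gives p S - (p - 1) M, where S is at least A^d - N B^d
    and M at most A^d. *)
Lemma cube_int_gdisc_ge : A ^+ d - p * N%:R * B ^+ d <=
  cube_int d (fun t => `|gdisc_fun x a t| `^ p).
Proof.
have h := cube_integralD
  (cube_integralZ (- p) cube_integral_gdisc_fun_words)
  (cube_integralZ (- (p - 1)) (cube_integral_words_exp alive)).
have [|t t01|+ _] := le_cube_int (H := fun t => `|gdisc_fun x a t| `^ p)
    (M := (\sum_k `|a k| + 1) `^ p) h.
- by move=> t _; rewrite !mulNr; exact: young_lower_bound.
- by rewrite powR_ge0 ge0_ler_powR ?gdisc_fun_bounded// ?ltW ?nnegrE ?addr_ge0 ?sumr_ge0.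
apply: le_trans; rewrite mulrNN mulNr.
have := ler_wpM2l (ltW p0) sum_alive_ge.
have := ler_wpM2l p1 (words_moment_le alive).
rewrite mulrBr mulrBl mul1r !mulrA; lra.
Qed.

End Words.
End FoolingFunction.

(** * The decomposition of t^s on the unit interval *)

Section Pieces.
Variable R : realType.
Local Notation I01 f := (Rintegral (@lebesgue_measure R) `[0, 1]%classic f).

Lemma I01_powR (p : R) : 0 < p -> I01 (fun t => t `^ p) = (p + 1)^-1.
Proof.
move=> p0; have p1 : 0 < p + 1 by rewrite addr_gt0.
(* Applied with r = p for continuity of the integrand and with r = p + 1 for the antiderivative; at
   0 only a one-sided limit is used. *)
have powR_oo (r : R) : 0 < r -> derivable_oo_LRcontinuous (fun t : R => t `^ r) 0 1.
  move=> r0; split.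
  - move=> x; rewrite in_itv/= => /andP[x0 _].
    by apply: derivable_powR; rewrite in_itv/= x0.
  - by rewrite powR0 ?gt_eqF//; exact: powR_cvg0.
  - have /derivable1_diffP/differentiable_continuous c1 :
      derivable (fun t : R => t `^ r) 1 1.
      by apply: derivable_powR; rewrite in_itv/= ltr01.
    exact/cvg_at_left_filter/c1.
rewrite /Rintegral (@continuous_FTC2 _ _ (fun t : R => (p + 1)^-1 * t `^ (p + 1)))//=.
- by rewrite powR1 powR0 ?gt_eqF// mulr0 mulr1 subr0.
- exact/derivable_oo_LRcontinuous_within/powR_oo.
- have [dF F0 F1] := powR_oo _ p1; split.
  + by move=> x /dF dx; exact: derivableM.
  + exact: cvgMr.
  + exact: cvgMr.
- move=> x; rewrite in_itv/= => /andP[x0 _].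
  have dx := is_derive1_powR (p + 1) x0.
  rewrite derive1E deriveZ/=; last first.
    by apply: derivable_powR; rewrite in_itv/= x0.
  by rewrite derive_val addrK -[LHS]/(_ * _) mulKf ?gt_eqF//.
Qed.

Variable s : R.
Hypothesis s0 : 0 < s.

Definition step (a t : R) : R := (t < a)%R%:R.

(** Equal to -1 on [1/4,1/2), to 1 from 3/4 on, and to 0 elsewhere. It has mean zero on [0,1], and
    its positive part lies to the right of its negative part. *)
Definition psi (t : R) : R := 1 - step (3 / 4) t - step 2^-1 t + step 4^-1 t.

(** Indexed by both values, so that one case analysis substitutes [step 4^-1 t] and [psi t]
    together. *)
Variant region (t : R) : R -> R -> Prop :=
| Region0 of t < 4^-1 : region t 1 0
| Region1 of 4^-1 <= t & t < 2^-1 : region t 0 (-1)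
| Region2 of 2^-1 <= t & t < 3 / 4 : region t 0 0
| Region3 of 3 / 4 <= t : region t 0 1.

Lemma regionP t : region t (step 4^-1 t) (psi t).
Proof.
rewrite /psi /step.
case: (ltP t 4^-1) => t1.
  have -> : t < 3 / 4 by lra.
  have -> : t < 2^-1 by lra.
  by rewrite subrr sub0r addNr; constructor.
case: (ltP t 2^-1) => t2.
  have -> : t < 3 / 4 by lra.
  by rewrite subrr sub0r addr0; constructor.
case: (ltP t (3 / 4)) => t3; rewrite ?subrr ?subr0 addr0; by constructor.
Qed.

(* Half the increase of [t ^ s] between the two intervals where [psi] is
   nonzero, so that [piece None] is larger where [psi = 1] than where [psi = -1]. *)
Definition eta : R := ((3 / 4) `^ s - 2^-1 `^ s) / 2.

(* [Some true], [Some false] and [None] index g_1, g_2 and g_0. *)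
Definition piece (c : option bool) (t : R) : R :=
  match c with
  | Some true => t `^ s * step 4^-1 t
  | Some false => eta * psi t
  | None => t `^ s - t `^ s * step 4^-1 t - eta * psi t
  end.

(** Every x is incompatible with exactly one of [Some true] and [Some false], so each coordinate of
    a node loses a positive first moment. *)
Definition piece_compat (c : option bool) (x : R) : bool :=
  match c with
  | Some true => x < 4^-1
  | Some false => 4^-1 <= x
  | None => true
  end.

Lemma big_option_bool (F : option bool -> R) :
  \sum_c F c = F None + F (Some true) + F (Some false).
Proof.
rewrite (bigD1 None)//= (bigD1 (Some true))//= (big_pred1 (Some false)) ?addrA//.
by case=> [[]|].
Qed.

Lemma sum_piece t : \sum_c piece c t = t `^ s.
Proof. by rewrite big_option_bool/=; ring. Qed.

Lemma eta_gt0 : 0 < eta.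
Proof.
rewrite divr_gt0// subr_gt0 gt0_ltr_powR// ?nnegrE; lra.
Qed.

Lemma powR_le a b : 0 <= a -> a <= b -> a `^ s <= b `^ s.
Proof. by move=> a0 ab; rewrite ge0_ler_powR ?nnegrE ?(ltW s0)// (le_trans a0). Qed.

Lemma bounded_meas_psi : bounded_meas psi.
Proof.
apply: bounded_measD (bounded_meas_lt _).
apply: bounded_measB (bounded_meas_lt _).
exact: bounded_measB (bounded_meas_cst _) (bounded_meas_lt _).
Qed.

Lemma bounded_meas_piece c : bounded_meas (piece c).
Proof.
have bs := bounded_meas_powR (ltW s0).
have b1 := bounded_measM bs (bounded_meas_lt 4^-1).
have b2 := bounded_measZ eta bounded_meas_psi.
case: c => [[]|] //=; exact: bounded_measB (bounded_measB bs b1) b2.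
Qed.

Lemma I01_psi : I01 psi = 0.
Proof.
rewrite I01D ?I01B ?I01_cst ?I01_lt; try lra.
all: try exact: bounded_meas_cst.
all: try exact: bounded_meas_lt.
exact: bounded_measB (bounded_meas_cst _) (bounded_meas_lt _).
exact: bounded_measB (bounded_measB (bounded_meas_cst _) (bounded_meas_lt _)) (bounded_meas_lt _).
Qed.

(** For [Some true] the step function starts beyond the support of the piece; for [Some false] the
    piece vanishes on [0,1/4), so the tail integral is the whole one, which is 0. *)
Lemma piece_vanish c x : ~~ piece_compat c x ->
  I01 (fun t => (x < t)%R%:R * piece c t) = 0.
Proof.
case: c => [[]|] //=; rewrite -?leNgt -?ltNge => x4.
  rewrite -[RHS]I01_cst; congr Rintegral; apply/funext => t.
  rewrite /step; case: ltP => xt; last by rewrite mul0r.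
  by rewrite ltNge (ltW (le_lt_trans x4 xt)) !mulr0.
rewrite (_ : (fun _ => _) = fun t => eta * psi t).
  by rewrite I01Z ?I01_psi ?mulr0//; exact: bounded_meas_psi.
apply/funext => t; case: ltP => xt; first by rewrite mul1r.
by rewrite mul0r; case: regionP; rewrite ?mulr0//; lra.
Qed.

Local Notation alpha c := (I01 (fun t => t * piece c t)).

Lemma alpha_true_gt0 : 0 < alpha (Some true).
Proof.
(* This constant bounds t t^s from below on [1/8,1/4). *)
have c0 : 0 < 8^-1 * 8^-1 `^ s :> R by rewrite mulr_gt0 ?powR_gt0 ?invr_gt0.
have bst a : bounded_meas (step a) by exact: bounded_meas_lt.
apply: (@lt_le_trans _ _
    (I01 (fun t => (8^-1 * 8^-1 `^ s) * (step 4^-1 t - step 8^-1 t)))).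
  rewrite I01Z ?I01B ?I01_lt//; try exact: bounded_measB; try lra.
apply: le_I01.
- exact/bounded_measZ/bounded_measB.
- exact: bounded_measM (@bounded_meas_id R) (bounded_meas_piece (Some true)).
move=> t /andP[t0 t1] /=; rewrite /step.
case: (ltP t 8^-1) => t8.
  have -> : t < 4^-1 by lra.
  by rewrite subrr mulr0 mulr1 mulr_ge0 ?powR_ge0.
case: ltP => t4; last by rewrite subrr !mulr0.
rewrite subr0 !mulr1 ler_pM ?powR_ge0 ?powR_le//; lra.
Qed.

Lemma alpha_false_gt0 : 0 < alpha (Some false).
Proof.
have e0 := eta_gt0.
(* On [0,1], t psi(t) is at least psi(t)/2 plus 1/4 on [3/4,1]. Since psi has mean zero, eta/16
   remains. *)
apply: (@lt_le_trans _ _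
    (I01 (fun t => eta * (2^-1 * psi t + 4^-1 * (1 - step (3 / 4) t))))).
  have b1 := bounded_measZ 2^-1 bounded_meas_psi.
  have b3 := bounded_measB (bounded_meas_cst 1) (bounded_meas_lt (3 / 4 : R)).
  have b2 := bounded_measZ 4^-1 b3.
  rewrite I01Z; last exact: bounded_measD.
  rewrite I01D// !I01Z//; last exact: bounded_meas_psi.
  rewrite I01_psi I01B ?I01_cst ?I01_lt; try lra.
  - exact: bounded_meas_cst.
  - exact: bounded_meas_lt.
apply: le_I01.
- apply/bounded_measZ/bounded_measD; apply: bounded_measZ.
    exact: bounded_meas_psi.
  exact: bounded_measB (bounded_meas_cst 1) (bounded_meas_lt (3 / 4 : R)).
- exact: bounded_measM (@bounded_meas_id R) (bounded_meas_piece (Some false)).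
move=> t /andP[t0 t1] /=; rewrite mulrCA ler_pM2l// /step.
by case: regionP => h1 *; case: ltP => h2 /=; lra.
Qed.

(** Subtraction of eta occurs only for t at least 3/4, where t^s is at least (3/4)^s, which exceeds
    eta. *)
Lemma piece_None_ge0 t : 0 <= t -> 0 <= piece None t.
Proof.
move=> t0 /=; have e0 := eta_gt0; have ts := powR_ge0 t s.
case: regionP => h *; rewrite ?mulr1 ?mulr0 ?mulrN1; try lra.
have := powR_le (_ : 0 <= 3 / 4) h.
have := powR_ge0 2^-1 s; have := powR_ge0 (3 / 4) s.
rewrite /eta; lra.
Qed.

Lemma alpha_ge0 c : 0 <= alpha c.
Proof.
case: c => [[]|]; [exact/ltW/alpha_true_gt0|exact/ltW/alpha_false_gt0|].
by apply: I01_ge0 => t /andP[t0 _]; rewrite mulr_ge0// piece_None_ge0.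
Qed.

(** A factor [Some true] confines the product to [0,1/4), where all pieces are nonnegative.
    Otherwise the product is a power of eta psi times a power of g_0; an even power of psi is
    nonnegative, and an odd one equals psi. *)
Lemma piece_moment_ge0 q (F : {ffun 'I_q -> option bool}) :
  0 <= I01 (fun t => \prod_j piece (F j) t).
Proof.
have [/existsP[j /eqP Fj]|] := boolP [exists j, F j == Some true].
  apply: I01_ge0 => t /andP[t0 _].
  case: (ltP t 4^-1) => t4; last first.
    by rewrite (bigD1 j)//= Fj/= /step ltNge t4/= mulr0 mul0r.
  apply: prodr_ge0 => i _; have ts := powR_ge0 t s.
  case: (F i) => [[]|] /=; case: regionP; rewrite ?mulr1 ?mulr0; lra.
rewrite negb_exists => /forallP nF.
pose n := #|[pred j | F j == Some false]|.
pose m := #|[pred j | F j != Some false]|.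
have prodE t : \prod_j piece (F j) t = (eta * psi t) ^+ n * piece None t ^+ m.
  rewrite (bigID (fun j => F j == Some false))/= -!prodr_const.
  congr (_ * _); apply: eq_big => // j; first by move=> /eqP ->.
  by have := nF j; case: (F j) => [[]|].
rewrite (_ : (fun _ => _) = (fun t => (eta * psi t) ^+ n * piece None t ^+ m));
  last exact/funext.
have e0 := eta_gt0.
(* For odd n, [piece None ^+ m] is compared with its threshold [k ^+ m] on
   either side of the sign change of [psi], whose integral is zero. *)
have [on|en] := boolP (odd n); last first.
  apply: I01_ge0 => t /andP[t0 _].
  by rewrite mulr_ge0 ?(exprn_even_ge0 _ en) ?exprn_ge0// piece_None_ge0.
(* The midpoint of (1/2)^s and (3/4)^s: g_0 = t^s + eta is at most k where psi = -1, and g_0 = t^s -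
   eta is at least k where psi = 1. *)
pose k := ((3 / 4) `^ s + 2^-1 `^ s) / 2.
have k0 : 0 <= k by rewrite divr_ge0// addr_ge0 ?powR_ge0.
have {1}<- : I01 (fun t => (eta ^+ n * k ^+ m) * psi t) = 0.
  by rewrite I01Z ?I01_psi ?mulr0//; exact: bounded_meas_psi.
apply: le_I01.
- exact/bounded_measZ/bounded_meas_psi.
- apply: bounded_measM; apply: bounded_meas_exp.
    exact: (bounded_meas_piece (Some false)).
  exact: (bounded_meas_piece None).
move=> t /andP[t0 t1]; rewrite (exprMn n eta (psi t)) -!mulrA ler_pM2l ?exprn_gt0//.
rewrite [leLHS]mulrC.
have := piece_None_ge0 t0 => /=.
have n0 : (0 < n)%N by case: (n) on.
case: regionP => h1; rewrite ?expr0n ?gtn_eqF// ?mul0r ?expr1n ?mul1r//.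
- move=> h2 g0; rewrite -signr_odd on expr1 !mulN1r lerN2.
  rewrite lerXn2r ?nnegrE//; have := powR_le t0 (ltW h2).
  by rewrite /k /eta; lra.
- move=> g0; rewrite lerXn2r ?nnegrE//.
  by have := powR_le (_ : 0 <= 3 / 4) h1; rewrite /k /eta; lra.
Qed.

End Pieces.

(** * The lower bound *)

Lemma cube_int_gdisc_lower (R : realType) (p : R) (q : nat) :
  1 < p -> (0 < q)%N -> ~~ odd q -> p^-1 + (q%:R)^-1 = 1 ->
  exists2 rho : R, 0 < rho < 1 &
    forall d N (x : 'I_N -> 'I_d -> R) (a : 'I_N -> R),
      (p + 1)^-1 ^+ d * (1 - p * N%:R * rho ^+ d) <=
      cube_int d (fun t => `|gdisc_fun x a t| `^ p).
Proof.
move=> p1 q0 evq pq; have p0 : 0 < p by exact: lt_trans p1.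
(* With this exponent both t t^s and (t^s)^q equal t^p, which yields the common value A of the two
   moments. *)
pose s := p - 1; have s0 : 0 < s by rewrite subr_gt0.
pose A : R := (p + 1)^-1; have A0 : 0 < A by rewrite invr_gt0 addr_gt0.
pose al c := Rintegral (@lebesgue_measure R) `[0, 1]%classic
  (fun t => t * piece s c t).
have IA : Rintegral (@lebesgue_measure R) `[0, 1]%classic
    (fun t => t * \sum_c piece s c t) = A.
  rewrite /A -I01_powR//; apply: eq_Rintegral => t.
  rewrite inE/= in_itv/= => /andP[t0 _].
  by rewrite sum_piece mulr_powRB1.
have sq : s * q%:R = p.
  have q1 : q%:R != 0 :> R by rewrite pnatr_eq0 -lt0n.
  apply: (mulfI (_ : q%:R^-1 != 0)); first by rewrite invr_eq0.
  rewrite mulrCA mulVf// mulr1 /s -{1}(mulfV (lt0r_neq0 p0)).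
  rewrite -[X in X - _]mulr1 -{1}pq mulrDr.
  by rewrite addrC addKr mulrC.
have IAq : Rintegral (@lebesgue_measure R) `[0, 1]%classic
    (fun t => (\sum_c piece s c t) ^+ q) = A.
  rewrite /A -I01_powR//; apply: eq_Rintegral => t _.
  by rewrite sum_piece -powR_mulrn ?powR_ge0// -powRrM sq.
have alA : al None + al (Some true) + al (Some false) = A.
  rewrite -IA -big_option_bool -I01_sum; last first.
    move=> c; exact: bounded_measM (@bounded_meas_id R) (bounded_meas_piece s0 c).
  by congr Rintegral; apply/funext => t; rewrite mulr_sumr.
have al0 : 0 <= al None by exact: alpha_ge0.
have al1 : 0 < al (Some true) by exact: alpha_true_gt0.
have al2 : 0 < al (Some false) by exact: alpha_false_gt0.
(* Each coordinate of a node excludes one of the two letters, so at most A - b survives there. *)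
pose b := Num.min (al (Some true)) (al (Some false)).
have [b1 b2] : b <= al (Some true) /\ b <= al (Some false).
  by split; rewrite ge_min lexx ?orbT.
have b0 : 0 < b by rewrite lt_min al1 al2.
exists ((A - b) / A).
  by rewrite divr_gt0//= ?ltr_pdivrMr//; lra.
move=> d N x a; rewrite expr_div_n mulrBr mulr1.
rewrite [_ * (p * _ * _)]mulrCA [_ * (_ / _)]mulrCA mulfV ?expf_neq0 ?gt_eqF// mulr1.
apply: (cube_int_gdisc_ge (gam := piece s) (compat := @piece_compat R) (q := q)) => //.
- by rewrite subr_ge0 ltW.
- exact: bounded_meas_piece.
- exact: piece_vanish.
- exact: alpha_ge0.
- move=> y; change (\sum_(c | piece_compat c y) al c <= A - b).
  rewrite big_mkcond big_option_bool/= ltNge.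
  by case: (4^-1 <= y) => /=; lra.
- exact: piece_moment_ge0.
Qed.

(** Taking p-th roots: since m and 1/p are at most 1, m^(1/p) is at least m, which keeps the bound
    linear in m. *)
Lemma gdisc_lower (R : realType) (p m : R) (d N : nat) :
  1 < p -> 0 < m <= 1 ->
  (forall (x : 'I_N -> 'I_d -> R) (a : 'I_N -> R),
    (p + 1)^-1 ^+ d * m <= cube_int d (fun t => `|gdisc_fun x a t| `^ p)) ->
  m * gdisc0 p d <= gdisc p N d.
Proof.
move=> p1 /andP[m0 m1] low; have p0 : 0 < p by exact: lt_trans p1.
apply: lb_le_inf.
  (* The infimum bound needs a nonempty set: all nodes at the origin, with zero coefficients. *)
  exists (gLp p (fun (_ : 'I_N) (_ : 'I_d) => 0) (fun=> 0)).
  by exists (fun _ _ => 0), (fun=> 0); split => // k i; rewrite lexx ltr01.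
move=> _ [x [a [_ ->]]].
have A0 : 0 < (p + 1)^-1 by rewrite invr_gt0 addr_gt0.
apply: (@le_trans _ _ (((p + 1)^-1 ^+ d * m) `^ p^-1)); last first.
  have lo0 : 0 <= (p + 1)^-1 ^+ d * m by rewrite mulr_ge0 ?exprn_ge0 ?ltW.
  by rewrite ge0_ler_powR ?invr_ge0 ?(ltW p0) ?nnegrE// (le_trans lo0).
rewrite powRM ?exprn_ge0 ?(ltW A0) ?(ltW m0)// mulrC.
have -> : ((p + 1)^-1 ^+ d) `^ p^-1 = gdisc0 p d.
  by rewrite exprVn -powR_invn ?addr_ge0 ?(ltW p0)// -powRrM.
rewrite ler_wpM2l ?powR_ge0// ger1_powR ?m0//.
by rewrite invf_le1 ?ltW.
Qed.

(** The inverse appears through all admissible N, hence in particular the least one. *)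
Theorem theorem3 (R : realType) (l : nat) (hl : (0 < l)%N) :
  let p : R := (2 * l)%:R / (2 * l - 1)%:R in
  exists C : R, 1 < C /\
    forall eps : R, 0 < eps -> eps < 1 ->
      exists r : nat -> R, r @ \oo --> (0 : R) /\
        forall d : nat, (1 <= d)%N ->
          forall N : nat, gdisc p N d <= eps * gdisc0 p d ->
            C ^+ d * (1 + r d) <= N%:R.
Proof.
move=> p.
have l1 : (1 <= 2 * l)%N by rewrite muln_gt0.
have w0 : 0 < (2 * l - 1)%:R :> R by rewrite ltr0n subn_gt0 (leq_pmulr 2 hl).
have wE : (2 * l)%:R = (2 * l - 1)%:R + 1 :> R by rewrite natrB// subrK.
have p1 : 1 < p by rewrite /p ltr_pdivlMr// mul1r wE ltrDl.
have p0 : 0 < p by exact: lt_trans p1.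
have pq : p^-1 + ((2 * l)%:R)^-1 = 1.
  by rewrite /p invf_div -[X in _ + X]mul1r -mulrDl -wE mulfV// pnatr_eq0 -lt0n.
have [|rho /andP[rho0 rho1] low] := cube_int_gdisc_lower p1 l1 _ pq.
  by rewrite oddM.
(* C lies strictly between 1 and 1/rho, so delta = rho C < 1 and delta^d eventually absorbs the
   constant (1 - eps)/p, while C itself is free of eps. *)
exists (2 / (1 + rho)); split; first by rewrite ltr_pdivlMr; lra.
move=> eps e0 e1.
pose c := (1 - eps) / p; pose delta := rho * (2 / (1 + rho)).
have c0 : 0 < c by rewrite divr_gt0 ?subr_gt0.
have delta0 : 0 < delta by rewrite mulr_gt0// divr_gt0//; lra.
have delta1 : delta < 1 by rewrite /delta mulrA ltr_pdivrMr; lra.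
(* The value -1 makes the bound trivial for the finitely many d with delta^d > c. *)
exists (fun d => if delta ^+ d <= c then 0 else -1); split.
  apply: cvg_near_cst.
  have : GRing.exp delta @ \oo --> (0 : R) by apply: cvg_expr; rewrite gtr0_norm.
  by move=> /cvgr_le /(_ _ c0); apply: filterS => d ->.
move=> d _ N gd; case: ifPn => [dc|_]; last by rewrite subrr mulr0.
rewrite addr0 mulr1.
have rd0 : 0 < rho ^+ d by rewrite exprn_gt0.
suff : c <= N%:R * rho ^+ d.
  move=> h; rewrite -(ler_pM2r rd0) -exprMn (_ : _ * rho = delta).
    exact: le_trans h.
  exact: mulrC.
(* Otherwise 1 - p N rho^d > eps, so the discrepancy would exceed eps times the initial one. *)
rewrite leNgt; apply/negP => h.
have h' : p * N%:R * rho ^+ d < 1 - eps.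
  by move: h; rewrite /c ltr_pdivlMr// mulrC mulrA.
have pN : 0 <= p * N%:R * rho ^+ d by rewrite !mulr_ge0// ltW.
have g0 : 0 < gdisc0 p d by rewrite powR_gt0// addr_gt0.
have := gdisc_lower p1 (_ : 0 < 1 - p * N%:R * rho ^+ d <= 1) (low d N).
move=> /(_ _) /le_trans /(_ gd); rewrite ler_pM2r//; lra.
Qed.
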